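(* Let $p\ge1$, $T>0$, $r>0$, and let $\mathbf x\in C^{p\text{-var}}([0,\infty),\mathfrak g)$, where $\mathfrak g=\mathfrak g^N(\mathbb R^d)$ with $N\ge2$. Let $\omega_{\mathbf x}(s,t)=\|\mathbf x\|^p_{p\text{-var};[s,t]}$ be the control induced by $\mathbf x$, let $(\sigma_n^r)_{n\ge0}=(\sigma_n^r(\mathbf x))_{n\ge0}$ be the greedy times of $\mathbf x$ at level $r$ for $d_{CC}$, and let $N_0^r=N_0^r(\mathbf x,[0,T])$. Then the accumulated local $p$-variation of $\mathbf x$ satisfies $$M(\mathbf x,[0,T])\le N_0^r+\sum_{j=1}^{N_0^r}\omega_{\mathbf x}\big(\sigma_{j-1}^r,\sigma_j^r\big)+\omega_{\mathbf x}\big(\sigma_{N_0^r}^r,T\big).$$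
   Context: **Group.** Fix $d\ge1$ and equip $\mathbb R^d$ with the Euclidean norm. $\mathfrak g=\mathfrak g^N(\mathbb R^d)$ is the Lie algebra generated by $\mathbb R^d$ inside the truncated tensor algebra $T^N(\mathbb R^d)=\bigoplus_{k=0}^N(\mathbb R^d)^{\otimes k}$ (commutator bracket of the truncated tensor product). It is a Lie group under $A\ast B:=\log(\exp(A)\exp(B))$ with identity $0$, where $\exp,\log$ are the power series in the truncated tensor algebra. For a continuous finite-variation path $\gamma:[0,1]\to\mathbb R^d$, $S_N(\gamma)_{0,1}=1+\sum_{k=1}^N\int_{0<t_1<\dots<t_k<1}d\gamma_{t_1}\otimes\cdots\otimes d\gamma_{t_k}$, and the Carnot–Carathéodory norm is $\|g\|_{CC}=\inf\{\|\gamma\|_{1\text{-var};[0,1]}:\log S_N(\gamma)_{0,1}=g\}$. The left-invariant metric is $d_{CC}(g,h)=\|g^{-1}\ast h\|_{CC}$. For a path $\mathbf x$ in $\mathfrak g$, $\mathbf x_{s,t}:=\mathbf x_s^{-1}\ast\mathbf x_t$. **Path space.** $\|\mathbf x\|_{p\text{-var};[s,t]}=\big(\sup_D\sum_j\|\mathbf x_{t_j,t_{j+1}}\|_{CC}^p\big)^{1/p}$, supremum over partitions $D=(t_j)$ of $[s,t]$. $C^{p\text{-var}}([0,\infty),\mathfrak g)$ is the set of continuous paths $[0,\infty)\to\mathfrak g$ with finite $p$-variation on every $[0,T]$. The function $\omega_{\mathbf x}$ is a control: continuous, non-negative, super-additive, zero on the diagonal. **Greedy times.** $\sigma_0^r=0$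 and, for $n\ge1$, $\sigma_n^r=\inf\{t\ge\sigma_{n-1}^r:d_{CC}(\mathbf x_{\sigma_{n-1}^r},\mathbf x_t)\ge r\}$ (with $\inf\emptyset=\infty$, and $\sigma^r_n=\infty$ if $\sigma^r_{n-1}=\infty$). $N_0^r(\mathbf x,[0,T])=\sup\{n\ge0:\sigma_n^r<T\}$. **Accumulated local $p$-variation.** $M(\mathbf x,[0,T])=\sup_D\sum_i\omega_{\mathbf x}(t_i,t_{i+1})$, the supremum over all partitions $D=(t_i)$ of $[0,T]$ with $\omega_{\mathbf x}(t_i,t_{i+1})\le1$ for all $i$. *)

(* Defs.v *)
From HB Require Import structures.
From mathcomp Require Import all_boot all_order all_algebra.
From mathcomp Require Import all_classical all_reals all_analysis.

Set Implicit Arguments.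
Unset Strict Implicit.
Unset Printing Implicit Defensive.

Import Order.TTheory GRing.Theory Num.Theory.
Import numFieldNormedType.Exports.

Local Open Scope classical_set_scope.
Local Open Scope ring_scope.

(* An element of T^N(R^d) is given by its coordinates in the basis
   e_{i_1} (x) ... (x) e_{i_k}, 0 <= k <= N, which is indexed by the words
   i_1 ... i_k of length at most N. The ring product declared below is the
   truncated tensor product, not the pointwise product of {ffun _ -> _}. *)
Definition tensor (R : realType) (d N : nat) := {ffun N.-bseq 'I_d -> R}.

HB.instance Definition _ (R : realType) (d N : nat) :=
  GRing.Lmodule.on (tensor R d N).

Section TensorRing.
Context (R : realType) (d N : nat).
Implicit Types a b c : tensor R d N.

Definition tensor_one : tensor R d N :=
  [ffun w : N.-bseq 'I_d => (w == [::] :> seq 'I_d)%:R].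

Definition tensor_mul a b : tensor R d N :=
  [ffun w : N.-bseq 'I_d => \sum_(u : N.-bseq 'I_d)
    \sum_(v : N.-bseq 'I_d | u ++ v == w :> seq 'I_d) a u * b v].

Lemma sum_bseq (s : seq 'I_d) (P : pred (seq 'I_d)) (x : R) :
    (P s -> (size s <= N)%N) ->
  \sum_(t : N.-bseq 'I_d | P t) (if s == t :> seq 'I_d then x else 0) =
  if P s then x else 0.
Proof.
move=> sN; have [Ps|nPs] := boolP (P s).
  rewrite (bigD1 (Bseq (sN Ps)))//= eqxx big1 ?addr0// => t /andP[_ st].
  by case: eqP => // stE; case/eqP: st; apply: val_inj.
by rewrite big1// => t Pt; case: eqP => // st; rewrite st Pt in nPs.
Qed.

Lemma tensor_mulA : associative tensor_mul.
Proof.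
move=> a b c; apply/ffunP => w; rewrite !ffunE.
transitivity (\sum_(u : N.-bseq 'I_d) \sum_(v : N.-bseq 'I_d)
    \sum_(z : N.-bseq 'I_d) (if u ++ (v ++ z) == w :> seq 'I_d
                             then a u * b v * c z else 0)).
  apply: eq_bigr => u _.
  under eq_bigr => t _.
    rewrite ffunE mulr_sumr.
    under eq_bigr => v _ do rewrite mulr_sumr big_mkcond.
    over.
  rewrite exchange_big; apply: eq_bigr => v _.
  rewrite exchange_big; apply: eq_bigr => z _.
  rewrite (@sum_bseq _ (fun t => u ++ t == w)) ?mulrA// => /eqP uvz.
  by rewrite (leq_trans _ (size_bseq w))// -uvz [leqRHS]size_cat leq_addl.
apply/esym; under eq_bigr => t _.
  rewrite big_mkcond.
  under eq_bigr => z _.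
    rewrite ffunE mulr_suml.
    under eq_bigr => u _ do rewrite mulr_suml big_mkcond.
    rewrite -[X in if X then _ else _]andTb.
    over.
  over.
rewrite exchange_big /=.
under eq_bigr => z _.
  rewrite -big_mkcond exchange_big /=.
  under eq_bigr => u _ do rewrite exchange_big /=.
  over.
rewrite exchange_big; apply: eq_bigr => u _.
rewrite exchange_big; apply: eq_bigr => v _.
apply: eq_bigr => z _.
rewrite (@sum_bseq _ (fun t => t ++ z == w)) ?catA// => /eqP uvz.
by rewrite (leq_trans _ (size_bseq w))// -uvz [leqRHS]size_cat leq_addr.
Qed.

Lemma tensor_mul1l : left_id tensor_one tensor_mul.
Proof.
move=> a; apply/ffunP => w; rewrite !ffunE (bigD1 [bseq])//= [X in _ + X]big1.
  by rewrite addr0 (big_pred1 w)// ffunE eqxx mul1r.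
move=> u u0; rewrite big1// => v _; rewrite ffunE.
by rewrite [_ == _](_ : _ = false) ?mul0r//; apply/negbTE.
Qed.

Lemma tensor_mul1r : right_id tensor_one tensor_mul.
Proof.
move=> a; apply/ffunP => w; rewrite !ffunE.
under eq_bigr do rewrite big_mkcond; rewrite exchange_big.
rewrite (bigD1 [bseq])//= [X in _ + X]big1.
  rewrite addr0 -big_mkcond (big_pred1 w) => [|v].
    by rewrite ffunE eqxx mulr1.
  by rewrite cats0; exact: (val_eqE v w).
move=> u u0; rewrite big1// => v _; rewrite ffunE.
by rewrite [u == _ :> seq _](_ : _ = false) ?mulr0 ?if_same//; apply/negbTE.
Qed.

Lemma tensor_mulDl : left_distributive tensor_mul +%R.
Proof.
move=> a b c; apply/ffunP => w; rewrite !ffunE -big_split; apply: eq_bigr => u _.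
by rewrite -big_split; apply: eq_bigr => v _; rewrite ffunE mulrDl.
Qed.

Lemma tensor_mulDr : right_distributive tensor_mul +%R.
Proof.
move=> a b c; apply/ffunP => w; rewrite !ffunE -big_split; apply: eq_bigr => u _.
by rewrite -big_split; apply: eq_bigr => v _; rewrite ffunE mulrDr.
Qed.

HB.instance Definition _ := GRing.Zmodule_isPzRing.Build (tensor R d N)
  tensor_mulA tensor_mul1l tensor_mul1r tensor_mulDl tensor_mulDr.

End TensorRing.

Section Group.
Context (R : realType) (d N : nat).
Implicit Types (a b g h : tensor R d N).

(* As a vector space R^d sits in T^N(R^d) as the words of length one. *)
Definition tensor_vec (v : 'rV[R]_d) : tensor R d N :=
  [ffun w : N.-bseq 'I_d =>
    (if bseqval w is [:: i] then v ord0 i else 0) : R].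

Definition lie_subalgebra (V : set (tensor R d N)) : Prop :=
  [/\ V 0,
      forall (k : R) a b, V a -> V b -> V (k *: a + b) &
      forall a b, V a -> V b -> V (a * b - b * a)].

Definition free_nilpotent : set (tensor R d N) :=
  smallest lie_subalgebra (range tensor_vec).

(* The power series, used only at a and g with a [::] = 0 and g [::] = 1,
   where a and g - 1 are nilpotent of order N.+1: the omitted terms vanish. *)
Definition texp a : tensor R d N :=
  \sum_(0 <= k < N.+1) k`!%:R^-1 *: a ^+ k.

Definition tlog g : tensor R d N :=
  \sum_(1 <= k < N.+1) ((-1) ^+ k.+1 / k%:R) *: (g - 1) ^+ k.

Definition gmul a b : tensor R d N := tlog (texp a * texp b).

(* exp(a) exp(-a) = 1, hence -a is the inverse of a for gmul. *)
Definition ginv a : tensor R d N := - a.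

End Group.

Section Paths.
Context (R : realType).

Definition partition_sum (phi : R -> R -> \bar R) (a : R) (D : seq R) : \bar R :=
  (\sum_(0 <= j < size D) phi (nth a (a :: D) j) (nth a (a :: D) j.+1))%E.

(* Riemann-Stieltjes integral of f against g over [a, b] (0 if undefined):
   limit of the tagged sums as the mesh of the partition tends to 0. *)
Definition is_RSint (f g : R -> R) (a b v : R) : Prop :=
  forall e : R, 0 < e -> exists2 delta : R, 0 < delta &
    forall (D : seq R) (tag : nat -> R),
      itv_partition a b D ->
      (forall j, (j < size D)%N ->
         nth a (a :: D) j.+1 - nth a (a :: D) j < delta /\
         nth a (a :: D) j <= tag j <= nth a (a :: D) j.+1) ->
      `|\sum_(0 <= j < size D)
          f (tag j) * (g (nth a (a :: D) j.+1) - g (nth a (a :: D) j)) - v| < e.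

Definition RSint (f g : R -> R) (a b : R) : R :=
  xget 0 [set v | is_RSint f g a b v].

Context (d N : nat).

(* The word is read backwards: for w = i_k :: ... :: i_1, the value at t is the
   integral of d gamma^{i_1}_{t_1} ... d gamma^{i_k}_{t_k} over
   0 < t_1 < ... < t_k < t. *)
Fixpoint iterated_integral (gamma : R -> 'rV[R]_d) (w : seq 'I_d) : R -> R :=
  if w is i :: w' then
    fun t => RSint (iterated_integral gamma w') (fun s => gamma s ord0 i) 0 t
  else fun=> 1.

Definition signature (gamma : R -> 'rV[R]_d) : tensor R d N :=
  [ffun w : N.-bseq 'I_d => iterated_integral gamma (rev w) 1].

(* `|v| on 'rV[R]_d is the sup norm, hence an explicit Euclidean norm. *)
Definition enorm (v : 'rV[R]_d) : R := Num.sqrt (\sum_i v ord0 i ^+ 2).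

Definition one_var (gamma : R -> 'rV[R]_d) (a b : R) : \bar R :=
  ereal_sup [set partition_sum (fun s t => (enorm (gamma t - gamma s))%:E) a D
            | D in itv_partition a b].

Definition ccnorm (g : tensor R d N) : \bar R :=
  ereal_inf [set one_var gamma 0 1 | gamma in
    [set gamma : R -> 'rV[R]_d |
      [/\ {within `[0, 1], continuous gamma},
          (one_var gamma 0 1 < +oo)%E &
          tlog (signature gamma) = g]]].

Definition ccdist (g h : tensor R d N) : \bar R := ccnorm (gmul (ginv g) h).

Implicit Types (p r s t T : R) (x : R -> tensor R d N).

Definition pvar p x s t : \bar R :=
  ((ereal_sup [set partition_sum (fun u v => ccdist (x u) (x v) `^ p) s D
              | D in itv_partition s t]) `^ p^-1)%E.

Definition omega p x s t : \bar R := (pvar p x s t `^ p)%E.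

(* Only the restriction of x to [0, +oo[ is meaningful. Continuity is that of
   a path in the metric space (g, d_CC). *)
Definition Cpvar p x : Prop :=
  [/\ forall t, 0 <= t -> free_nilpotent (x t),
      forall s, 0 <= s ->
        ccdist (x s) (x t) @[t --> within `[0, +oo[ (nbhs s)] --> 0%E &
      forall T, 0 <= T -> (pvar p x 0 T < +oo)%E].

Fixpoint greedy_time x r (n : nat) : \bar R :=
  if n is m.+1 then
    if greedy_time x r m is s%:E then
      ereal_inf [set t%:E | t in
        [set t : R | s <= t /\ (r%:E <= ccdist (x s) (x t))%E]]
    else +oo%E
  else 0%E.

Definition greedy_count x r T : \bar R :=
  ereal_sup [set n%:R%:E | n in [set n : nat | (greedy_time x r n < T%:E)%E]].

Definition local_pvar p x T : \bar R :=
  ereal_sup [set partition_sum (omega p x) 0 D | D in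
    [set D : seq R | itv_partition 0 T D /\
      forall j, (j < size D)%N ->
        (omega p x (nth 0%R (0%R :: D) j) (nth 0%R (0%R :: D) j.+1) <= 1)%E]].

End Paths.

(* Main.v *)
(** A piece of an admissible partition that contains one of the [n0] greedy times
    in its interior contributes at most 1, and there are at most [n0] of them; the
    other pieces lie between consecutive greedy times, where superadditivity of
    [omega] bounds their sum. The count [n0] is finite because any two consecutive
    greedy steps contribute at least [r `^ p] to [omega p x 0 T]. *)

Require Import Defs.
From HB Require Import structures.
From mathcomp Require Import all_boot all_order all_algebra.
From mathcomp Require Import all_classical all_reals all_analysis.

Set Implicit Arguments.
Unset Strict Implicit.
Unset Printing Implicit Defensive.

Import Order.TTheory GRing.Theory Num.Theory.
Import numFieldNormedType.Exports.

Local Open Scope classical_set_scope.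
Local Open Scope ring_scope.

(** * Sums of a two-parameter function along partitions *)

Section PartitionSum.
Context (R : realType).
Implicit Types (phi : R -> R -> \bar R) (a b c : R) (D S : seq R).
Local Open Scope ereal_scope.

Lemma partition_sum_nil phi a : partition_sum phi a [::] = 0.
Proof. by rewrite /partition_sum big_geq. Qed.

Lemma partition_sum_cons phi a b D :
  partition_sum phi a (b :: D) = phi a b + partition_sum phi b D.
Proof.
rewrite /partition_sum /= big_nat_recl//=; congr (_ + _).
apply: eq_big_nat => j /andP[_ jD].
rewrite (set_nth_default b)//; last exact: ltnW.
by congr (phi _ _); apply: set_nth_default.
Qed.

Lemma partition_sum_cat phi a D S :
  partition_sum phi a (D ++ S) =
  partition_sum phi a D + partition_sum phi (last a D) S.
Proof.
elim: D a => [|b D ih] a; first by rewrite partition_sum_nil add0e.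
by rewrite cat_cons !partition_sum_cons ih addeA.
Qed.

Lemma partition_sum_ge0 phi a D :
  (forall s t, 0 <= phi s t) -> 0 <= partition_sum phi a D.
Proof. by move=> phi0; apply: sume_ge0. Qed.

Lemma partition_sum_map phi (f : nat -> R) m n :
  partition_sum phi (f m) (map f (iota m.+1 n)) =
  \sum_(m.+1 <= j < (m + n).+1) phi (f j.-1) (f j).
Proof.
elim: n m => [|n ih] m; first by rewrite partition_sum_nil addn0 big_geq.
by rewrite /= partition_sum_cons ih addnS addSn big_ltn// ltnS leq_addr.
Qed.

(** A finite [y] moves to the other side. If [y = +oo], some [u] in [A] is nonnegative, hence not
    [-oo], so [u + y = +oo] forces [z = +oo]. *)
Lemma ge_ereal_supD (A : set (\bar R)) (y z : \bar R) :
    A !=set0 -> (forall u, A u -> 0 <= u) -> 0 <= y ->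
    (forall u, A u -> u + y <= z) ->
  ereal_sup A + y <= z.
Proof.
move=> [u Au] A0; case: y => [y| |//] _ Az.
  by rewrite -leeBrDr//; apply: ge_ereal_sup => v Av; rewrite leeBrDr// Az.
have := Az _ Au; rewrite addey ?leye_eq; first by move=> /eqP ->; rewrite leey.
by apply/eqP => uNy; have := A0 _ Au; rewrite uNy.
Qed.

Lemma itv_partition_exists a b : (a <= b)%R -> exists D, itv_partition a b D.
Proof.
rewrite le_eqVlt => /predU1P[->|ab]; first by exists [::].
by exists [:: b]; apply: itv_partition1.
Qed.

(** Partitions of the two intervals concatenate to one of the whole, and their sums add; the suprema
    are then taken one at a time. *)
Lemma variation_superadditive phi a b c :
    (forall s t, 0 <= phi s t) -> (a <= b)%R -> (b <= c)%R ->
  ereal_sup [set partition_sum phi a D | D in itv_partition a b] +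
  ereal_sup [set partition_sum phi b D | D in itv_partition b c] <=
  ereal_sup [set partition_sum phi a D | D in itv_partition a c].
Proof.
move=> phi0 /itv_partition_exists[D0 abD0] /itv_partition_exists[E0 bcE0].
apply: ge_ereal_supD.
- by exists (partition_sum phi a D0), D0.
- by move=> _ [D _ <-]; exact: partition_sum_ge0.
- apply: le_ereal_sup_tmp; exists (partition_sum phi b E0); first by exists E0.
  exact: partition_sum_ge0.
move=> _ [D abD <-]; rewrite addeC; apply: ge_ereal_supD.
- by exists (partition_sum phi b E0), E0.
- by move=> _ [E _ <-]; exact: partition_sum_ge0.
- exact: partition_sum_ge0.
move=> _ [E bcE <-]; apply: ereal_sup_ubound.
exists (D ++ E); first exact: itv_partition_cat abD bcE.
by rewrite partition_sum_cat addeC; case: abD => _ /eqP ->.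
Qed.

(** * Small pieces of a partition against a chain of cut points *)

Section Superadditive.
Variable phi : R -> R -> \bar R.
Hypothesis phi_ge0 : forall s t, 0 <= phi s t.
Hypothesis phi_superadditive : forall a b c, (a <= b)%R -> (b <= c)%R ->
  phi a b + phi b c <= phi a c.

Lemma superadditive_leL a b c :
  (a <= b)%R -> (b <= c)%R -> phi b c <= phi a c.
Proof.
by move=> ab bc; apply: le_trans (phi_superadditive ab bc); rewrite leeDr.
Qed.

(** The points of [S] before [b] are discarded: their increments are nonnegative, and the first
    remaining increment only shrinks when its left end moves up to [b]. *)
Lemma partition_sum_drop a b c S :
    (a <= b)%R -> (b <= c)%R -> path <=%R a S -> (last a S <= c)%R ->
  exists S', [/\ path <=%R b S', (last b S' <= c)%R, (size S' <= size S)%N &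
    partition_sum phi b (rcons S' c) <= partition_sum phi a (rcons S c)].
Proof.
elim: S a => [|s S ih] a ab bc /=.
  move=> _ _; exists [::]; split => //=.
  by rewrite !partition_sum_cons leeD2r// superadditive_leL.
move=> /andP[as_ sS] lc; case: (leP b s) => [bs|/ltW sb].
  exists (s :: S); split => //=; first by rewrite bs.
  by rewrite !partition_sum_cons leeD2r// superadditive_leL.
have [S' [bS' lS' sS' le]] := ih s sb bc sS lc.
exists S'; split => //; first exact: leqW.
by apply: le_trans le _; rewrite partition_sum_cons leeDr.
Qed.

(* A piece of [D] that contains a point of [S] costs at most [1], and it uses up
   that point; the other pieces are absorbed by superadditivity. *)
Lemma partition_sum_le_size a c D S :
    itv_partition a c D ->
    (forall j, (j < size D)%N ->
      phi (nth a (a :: D) j) (nth a (a :: D) j.+1) <= 1) ->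
    path <=%R a S -> (last a S <= c)%R ->
  partition_sum phi a D <=
  (size S)%:R%:E + partition_sum phi a (rcons S c).
Proof.
elim: D a S => [|b D ih] a S.
  by rewrite partition_sum_nil adde_ge0// ?lee_fin// partition_sum_ge0.
move=> /[dup] abD /itv_partition_cons bD; have bc := itv_partition_le bD.
case: (abD) => /= /andP[/ltW ab _] _ small aS lS.
(* The chain stays open here: it will be empty, unchanged or trimmed, depending on where its first
   point lies. *)
have {}ih := ih b _ bD.
have small' j : (j < size D)%N ->
    phi (nth b (b :: D) j) (nth b (b :: D) j.+1) <= 1.
  move=> jD; rewrite (set_nth_default a)//; last exact: ltnW.
  by rewrite (set_nth_default a _ (n := j.+1))//; apply: (small j.+1).
rewrite partition_sum_cons.
case: S aS lS => [_ _|s S /= /andP[as_ sS] lS].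
  rewrite /= partition_sum_cons partition_sum_nil adde0 add0e.
  apply: (le_trans _ (phi_superadditive ab bc)); apply: leeD2l.
  have := ih [::] small' isT bc.
  by rewrite /= partition_sum_cons partition_sum_nil adde0 add0e.
case: (leP b s) => [bs|/ltW sb].
  have bsS : path <=%R b (s :: S) by rewrite /= bs.
  apply: le_trans (leeD2l _ (ih _ small' bsS lS)) _.
  rewrite /= !partition_sum_cons addeCA leeD2l// addeA leeD2r//.
  exact: phi_superadditive.
(* Further points of [S] may precede [b] as well. At most [size S] points survive, so the 1 spent on
   this piece is paid for by [s] alone. *)
have [S' [bS' lS' sS' le]] := partition_sum_drop sb bc sS lS.
have phi1 : phi a b <= 1 by exact: (small 0%N).
apply: le_trans (leeD phi1 (ih S' small' bS' lS')) _.
rewrite addeA; apply: leeD; first by rewrite -EFinD lee_fin nat1r ler_nat.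
by apply: le_trans le _; rewrite partition_sum_cons leeDr.
Qed.

End Superadditive.
End PartitionSum.

(** * The control induced by a path *)

Section Omega.
Context (R : realType) (d N : nat).
Implicit Types (x : R -> tensor R d N) (p r s t : R).
Local Open Scope ereal_scope.

Lemma ccdist_ge0 (g h : tensor R d N) : 0 <= ccdist g h.
Proof.
apply: le_ereal_inf_tmp => _ [gamma _ <-].
apply: le_ereal_sup_tmp; exists (partition_sum
  (fun s t => (enorm (gamma t - gamma s))%:E) 0%R [:: 1%R]).
  by exists [:: 1%R] => //; apply: itv_partition1.
by rewrite partition_sum_cons partition_sum_nil adde0 lee_fin sqrtr_ge0.
Qed.

(** The powers [p^-1] and [p] cancel on a nonnegative supremum; [s <= t] supplies a partition,
    without which the supremum would be [-oo]. *)
Lemma omegaE p x s t : (1 <= p)%R -> (s <= t)%R ->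
  omega p x s t = ereal_sup [set partition_sum
    (fun u v => ccdist (x u) (x v) `^ p) s D | D in itv_partition s t].
Proof.
move=> p1 st; have p0 : (p != 0)%R by rewrite gt_eqF// (lt_le_trans ltr01).
rewrite /omega /pvar -poweRrM mulVf// poweRe1//.
have [D stD] := itv_partition_exists st.
apply: le_ereal_sup_tmp; eexists; first by exists D.
by apply: partition_sum_ge0 => *; apply: poweR_ge0.
Qed.

Lemma omega_ge0 p x s t : 0 <= omega p x s t.
Proof. exact: poweR_ge0. Qed.

Lemma omega_superadditive p x a b c : (1 <= p)%R ->
    (a <= b)%R -> (b <= c)%R ->
  omega p x a b + omega p x b c <= omega p x a c.
Proof.
move=> p1 ab bc; rewrite !omegaE ?(le_trans ab bc)//.
by apply: variation_superadditive => // *; exact: poweR_ge0.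
Qed.

Lemma le_omega p x s t : (1 <= p)%R -> (s < t)%R ->
  ccdist (x s) (x t) `^ p <= omega p x s t.
Proof.
move=> p1 st; rewrite (omegaE x p1 (ltW st)); apply: ereal_sup_ubound.
exists [:: t]; first exact: itv_partition1.
by rewrite partition_sum_cons partition_sum_nil adde0.
Qed.

End Omega.

(** * Strict growth of the greedy times and finiteness of their count *)

Section Greedy.
Context (R : realType) (d N : nat) (p r : R) (x : R -> tensor R d N).
Hypotheses (p_ge1 : 1 <= p) (r_gt0 : 0 < r) (xC : Cpvar p x).
Local Open Scope ereal_scope.

Lemma greedy_time_le n : greedy_time x r n <= greedy_time x r n.+1.
Proof.
rewrite /=; case: (greedy_time x r n) => [s| |]; last 2 first.
- by [].
- exact: leNye.
by apply: le_ereal_inf_tmp => _ [t [st _] <-]; rewrite lee_fin.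
Qed.

Lemma greedy_time_homo m n : (m <= n)%N -> greedy_time x r m <= greedy_time x r n.
Proof.
by move=> mn; apply: (homo_leq lexx le_trans greedy_time_le).
Qed.

Lemma greedy_time_ge0 n : 0 <= greedy_time x r n.
Proof. exact: (greedy_time_homo (leq0n n)). Qed.

Lemma greedy_time_fin_num n T : greedy_time x r n < T%:E ->
  greedy_time x r n \is a fin_num.
Proof.
by move=> nT; rewrite ge0_fin_numE ?greedy_time_ge0// (lt_trans nT) ?ltry.
Qed.

(** By continuity at the current time [s], the distance from [x s] stays below [r] on some [[s, s +
    e[], so the next time is at least [s + e]. *)
Lemma greedy_time_lt n :
  greedy_time x r n < +oo -> greedy_time x r n < greedy_time x r n.+1.
Proof.
move=> noo; have := greedy_time_ge0 n; rewrite /=.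
case: (greedy_time x r n) noo => [s| |] // _; rewrite lee_fin => s0.
case: xC => _ /(_ s s0) cvg_x _.
have : nbhs (0 : \bar R) [set y | y < r%:E].
  by apply: filterS (lt_nbhsl r_gt0) => y; rewrite /= lte_fin.
move/cvg_x; rewrite /= => /nbhs_ballP[e /= e0 xe].
apply: (@lt_le_trans _ _ (s + e)%:E); first by rewrite lte_fin ltrDl.
apply: le_ereal_inf_tmp => _ [t [st rt] <-]; rewrite lee_fin leNgt.
apply/negP => tse; move: rt; rewrite leNgt => /negP; apply.
apply: xe => /=; last by rewrite in_itv/= andbT (le_trans s0).
by rewrite /ball/= distrC ger0_norm ?subr_ge0// ltrBlDl.
Qed.

(* Two greedy steps contain an increment of size at least [r]; this avoids the
   triangle inequality for [ccdist], which one step would need. *)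
Lemma omega_greedy_time k s : greedy_time x r k.*2 = s%:E ->
  (k%:R * r `^ p)%:E <= omega p x 0 s.
Proof.
elim: k s => [|k ih] s ks; first by rewrite mul0r omega_ge0.
have le02 : greedy_time x r k.*2.+1 < s%:E.
  by rewrite -ks doubleS greedy_time_lt// (le_lt_trans (greedy_time_le _))//
    -doubleS ks ltry.
have le01 : greedy_time x r k.*2 < s%:E := le_lt_trans (greedy_time_le _) le02.
have lt01 := greedy_time_lt (lt_trans le01 (ltry _)).
have := greedy_time_ge0 k.*2.
move: le01 le02 lt01 (ih); rewrite [greedy_time x r k.*2.+1]/=.
case: (greedy_time x r k.*2) => [u| |] // us inf_lt lt_inf {}ih u0.
(* Since the infimum lies strictly between [u] and [s], some [t] of its set does too; this [t], not
   the infimum, ends the increment of size at least [r]. *)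
have [_ [t [ut rt] <-] ts] := ereal_inf_lt inf_lt.
have {}ut : (u < t)%R.
  rewrite -lte_fin (lt_le_trans lt_inf)//; apply: ereal_inf_lbound.
  by exists t.
move: us ts u0; rewrite !lte_fin lee_fin => us /ltW ts u0.
apply: (@le_trans _ _ (omega p x 0 t)); last first.
  apply: le_trans (omega_superadditive x p_ge1 _ ts); last first.
    exact: le_trans u0 (ltW ut).
  by rewrite leeDl// omega_ge0.
apply: le_trans (omega_superadditive x p_ge1 u0 (ltW ut)).
rewrite -natr1 mulrDl mul1r EFinD; apply: leeD; first exact: ih.
apply: le_trans (le_omega x p_ge1 ut); rewrite -poweR_EFin.
apply: gt0_ler_poweR => //; first exact: le_trans p_ge1.
- by rewrite in_itv/= leey andbT lee_fin ltW.
- by rewrite in_itv/= leey andbT ccdist_ge0.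
Qed.

(** The indices of times before [T] are bounded because [omega p x 0 T] is finite, and 0 is one of
    them; the supremum is therefore a maximum. *)
Lemma greedy_count_nat T : (0 < T)%R ->
  exists2 n, greedy_time x r n < T%:E & greedy_count x r T = n%:R%:E.
Proof.
move=> T0; have omega_fin : omega p x 0 T < +oo.
  by apply: poweR_lty; case: xC => _ _; apply; exact: ltW.
have rp0 : (0 < r `^ p)%R by exact: powR_gt0.
(* Index [n] yields [n./2] disjoint pairs of steps; the final successor in the bound accounts for
   odd [n]. *)
have bnd n : greedy_time x r n < T%:E ->
    (n <= (Num.truncn (fine (omega p x 0 T) / r `^ p)).*2.+1)%N.
  move=> nT; rewrite -leq_half_double truncn_ge_nat; last first.
    by rewrite divr_ge0 ?fine_ge0 ?omega_ge0// ltW.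
  have kT : greedy_time x r n./2.*2 < T%:E.
    by apply: le_lt_trans (greedy_time_homo _) nT; rewrite -geq_half_double.
  have := greedy_time_ge0 n./2.*2; have := @omega_greedy_time n./2.
  move: kT (greedy_time_fin_num kT).
  case: (greedy_time x r n./2.*2) => [s| |] // sT _ /(_ _ erefl) ks s0.
  rewrite ler_pdivlMr// -lee_fin fineK ?ge0_fin_numE ?omega_ge0//.
  apply: le_trans ks (le_trans _ (omega_superadditive x p_ge1 s0 (ltW sT))).
  by rewrite leeDl// omega_ge0.
have ex0 : exists n, `[< greedy_time x r n < T%:E >].
  by exists 0%N; apply/asboolP; rewrite lte_fin.
have ub n : `[< greedy_time x r n < T%:E >] ->
    (n <= (Num.truncn (fine (omega p x 0 T) / r `^ p)).*2.+1)%N.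
  by move/asboolP/bnd.
case: (ex_maxnP ex0 ub) => n /asboolP nT nmax; exists n => //.
apply/le_anti/andP; split.
  apply: ge_ereal_sup => _ [m mT <-]; rewrite lee_fin ler_nat nmax//.
  exact/asboolP.
by apply: ereal_sup_ubound; exists n.
Qed.

End Greedy.

Theorem lemma5p2 (R : realType) (d N : nat) (p T r : R) (x : R -> tensor R d N)
    (d_ge1 : (1 <= d)%N) (N_ge2 : (2 <= N)%N)
    (p_ge1 : 1 <= p) (T_gt0 : 0 < T) (r_gt0 : 0 < r) (xC : Cpvar p x) :
  let sigma n : R := fine (greedy_time x r n) in
  exists n0 : nat,
    greedy_count x r T = n0%:R%:E /\
    (local_pvar p x T <=
      n0%:R%:E + \sum_(1 <= j < n0.+1) omega p x (sigma j.-1) (sigma j)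
      + omega p x (sigma n0) T)%E.
Proof.
move=> sigma; have [n nT ->] := greedy_count_nat p_ge1 r_gt0 xC T_gt0.
exists n; split => //; apply: ge_ereal_sup => _ [D [D0T small] <-].
have mT m : (m <= n)%N -> (greedy_time x r m < T%:E)%E.
  by move=> mn; apply: le_lt_trans nT; apply: greedy_time_homo.
(* [fine] would send [+oo] to 0; times before [T] are finite, so nothing is lost. *)
have sigmaK m : (m <= n)%N -> (sigma m)%:E = greedy_time x r m.
  by move=> /mT mT'; rewrite fineK// (greedy_time_fin_num mT').
have last_sigma m k : last (sigma m) (map sigma (iota m.+1 k)) = sigma (m + k)%N.
  by elim: k m => [|k ih] m /=; rewrite ?addn0// ih addSnnS.
have path_sigma m k : (m + k <= n)%N ->
    path <=%R (sigma m) (map sigma (iota m.+1 k)).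
  elim: k m => [//|k ih] m mk /=; have mn : (m < n)%N.
    by apply: leq_trans mk; rewrite addnS ltnS leq_addr.
  rewrite -lee_fin !sigmaK ?greedy_time_le//= ?ih//; last exact: ltnW.
  by rewrite addSnnS.
(* The cut points are [sigma 1] to [sigma n]: the start 0 is [sigma 0] and is not counted, so the
   chain has exactly [n] points. *)
have := @partition_sum_le_size _ (omega p x) (@omega_ge0 _ _ _ p x)
  (fun a b c => @omega_superadditive _ _ _ p x a b c p_ge1)
  0 T D (map sigma (iota 1 n)) D0T small (path_sigma 0%N n (leqnn n)).
rewrite (last_sigma 0%N) add0n -lee_fin sigmaK// => /(_ (ltW nT)).
rewrite -cats1 partition_sum_cat.
rewrite (partition_sum_map (omega p x) sigma 0%N) (last_sigma 0%N) add0n.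
by rewrite partition_sum_cons partition_sum_nil adde0 addeA size_map size_iota.
Qed.
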